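(* Let $m\geq 1$ and $0\leq l\leq m$, let $1\leq i_1\leq\cdots\leq i_l$ and $1\leq i_{l+1}\leq\cdots\leq i_m$ be integers, and let $q\geq 1$ be an integer. For a composition $\theta=(\theta_1,\theta_2,\ldots,\theta_p)\in\mathcal{C}_m$ (where $p$ is the number of parts of $\theta$), a permutation $\rho\in\mathcal{S}_m$ and $c=1,2,\ldots,p$, put $$\lambda_c=\sum_{k=1}^{\theta_c}\chi_{\mathbb{N}}\big(\rho(\theta_1+\cdots+\theta_{c-1}+k)-l\big),$$ $$\tilde{T}_c(\theta,\rho)=\begin{cases}\overline{i_{\rho(\theta_1+\cdots+\theta_{c-1}+1)}+\cdots+i_{\rho(\theta_1+\cdots+\theta_c)}}, & \text{if }\lambda_c\text{ is odd},\\ i_{\rho(\theta_1+\cdots+\theta_{c-1}+1)}+\cdots+i_{\rho(\theta_1+\cdots+\theta_c)}, & \text{if }\lambda_c\text{ is even},\end{cases}$$ $$\check{T}_1(\theta,\rho)=\begin{cases}\overline{q+i_{\rho(1)}+\cdots+i_{\rho(\theta_1)}}, & \text{if }\lambda_1\text{ is even},\\ q+i_{\rho(1)}+\cdots+i_{\rho(\theta_1)}, & \text{if }\lambda_1\text{ is odd}.\end{cases}$$ Then $$S_{i_1\cdots i_l\bar{i}_{l+1}\cdots\bar{i}_m,\bar{q}}=\sum_{\theta\in\mathcal{C}_m}\sum_{\rho\in\mathcal{S}_m}\frac{(-1)^{\lambda_1+\cdots+\lambda_p+1}}{\theta_1!\cdots\theta_p!}\Big\{\zeta\big(\bar{q}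,\tilde{T}_1(\theta,\rho),\ldots,\tilde{T}_p(\theta,\rho)\big)+\zeta\big(\check{T}_1(\theta,\rho),\tilde{T}_2(\theta,\rho),\ldots,\tilde{T}_p(\theta,\rho)\big)\Big\}.$$
   Context: Harmonic numbers and alternating harmonic numbers: $H_n^{(r)}=\sum_{k=1}^n\frac{1}{k^r}$ and $\bar{H}_n^{(r)}=\sum_{k=1}^n\frac{(-1)^{k-1}}{k^r}$ for positive integers $n,r$. Alternating Euler sums (second kind): $$S_{i_1\cdots i_l\bar{i}_{l+1}\cdots\bar{i}_m,\bar{q}}=\sum_{n=1}^{\infty}(-1)^{n-1}\frac{H_n^{(i_1)}\cdots H_n^{(i_l)}\bar{H}_n^{(i_{l+1})}\cdots\bar{H}_n^{(i_m)}}{n^q},$$ the infinite sum being the limit of its partial sums. Alternating multiple zeta values: for positive integers $s_j$ and signs $\sigma_j=\pm1$ with $(s_1,\sigma_1)\neq(1,1)$, $$\zeta(s_1,\ldots,s_k;\sigma_1,\ldots,\sigma_k)=\lim_{n\to\infty}\sum_{n\geq n_1>n_2>\cdots>n_k\geq 1}\frac{\sigma_1^{n_1}\cdots\sigma_k^{n_k}}{n_1^{s_1}\cdots n_k^{s_k}}.$$ The exponents and signs are combined into a single string, with $s_j$ in the $j$th position when $\sigma_j=+1$ and $\bar{s}_j$ (or $\overline{s_j}$) in the $j$th position when $\sigma_j=-1$; e.g. $\zeta(\bar{s}_1,s_2)=\zeta(s_1,s_2;-1,1)$. $\chi_{\mathbb{N}}$ is the characteristic function of the set of positive integers: $\chi_{\mathbb{N}}(x)=1$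 if $x$ is a positive integer and $0$ otherwise. $\mathcal{S}_m$ is the symmetric group on $\{1,\ldots,m\}$; a composition of $m$ is an ordered tuple of positive integers summing to $m$, and $\mathcal{C}_m$ is the set of all compositions of $m$. For $c=1$, the empty sum $\theta_1+\cdots+\theta_{c-1}$ is $0$. *)

(* Defs.v *)
From HB Require Import structures.
From mathcomp Require Import all_boot all_order all_algebra all_fingroup.
From mathcomp Require Import all_classical all_reals all_analysis.

Set Implicit Arguments.
Unset Strict Implicit.
Unset Printing Implicit Defensive.

Import Order.TTheory GRing.Theory Num.Theory.
Import numFieldNormedType.Exports.

Local Open Scope ring_scope.

Definition harmonic_number (R : realType) (n r : nat) : R :=
  \sum_(1 <= k < n.+1) 1 / k%:R ^+ r.

Definition alt_harmonic_number (R : realType) (n r : nat) : R :=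
  \sum_(1 <= k < n.+1) (-1) ^+ (k - 1)%N / k%:R ^+ r.

(* The indices i_1, ..., i_m are numbered from 0: the unbarred ones are the
   i j with j < l, the barred ones are the i j with l <= j. *)
Definition alt_euler_partial_sum (R : realType) (m l : nat) (i : 'I_m -> nat)
    (q N : nat) : R :=
  \sum_(1 <= n < N.+1)
    (-1) ^+ (n - 1)%N *
    ((\prod_(j < m | (j < l)%N) harmonic_number R n (i j)) *
     (\prod_(j < m | (l <= j)%N) alt_harmonic_number R n (i j))) / n%:R ^+ q.

Definition alt_euler_sum (R : realType) (m l : nat) (i : 'I_m -> nat)
    (q : nat) : R :=
  limn (alt_euler_partial_sum R l i q).

(* An entry (s, b) of the argument string of an alternating multiple zeta value
   is the exponent s with the sign -1 (a bar) if b = true, +1 if b = false. *)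
Definition az_entry : Type := (nat * bool)%type.

Definition unbarred (s : nat) : az_entry := (s, false).
Definition barred (s : nat) : az_entry := (s, true).

Definition az_sign (R : realType) (e : az_entry) : R := if e.2 then -1 else 1.

(* The sum over n >= f 0 > f 1 > ... > f (k - 1) >= 1, where k = size w. *)
Definition amzv_partial_sum (R : realType) (w : seq az_entry) (n : nat) : R :=
  \sum_(f : {ffun 'I_(size w) -> 'I_n.+1} |
         [forall a, (0 < f a)%N] &&
         [forall a : 'I_(size w), forall b : 'I_(size w),
            (a < b)%N ==> (f b < f a)%N])
    \prod_(a < size w)
      (az_sign R (nth (unbarred 0) w a) ^+ f a /
       (f a)%:R ^+ (nth (unbarred 0) w a).1).

Definition amzv (R : realType) (w : seq az_entry) : R :=
  limn (amzv_partial_sum R w).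

Definition is_composition (m : nat) (s : seq nat) : bool :=
  all (fun k => 0 < k)%N s && (sumn s == m).

Record composition (m : nat) : Type :=
  Composition { parts :> seq nat; _ : is_composition m parts }.

HB.instance Definition _ m := [isSub for @parts m].
HB.instance Definition _ m := [Countable of composition m by <:].

Fixpoint composition_enum_seq (m : nat) : seq (seq nat) :=
  if m is m'.+1 then
    [seq (1%N :: s) | s <- composition_enum_seq m'] ++
    [seq ((head 0%N s).+1 :: behead s) | s <- composition_enum_seq m' & s != [::]]
  else [:: [::]].

Lemma mem_composition_enum_seq m s :
  (s \in composition_enum_seq m) = is_composition m s.
Proof.
elim: m s => [|m IH] s /=.
  by rewrite inE; case: s => [|[|k] s] //; rewrite /is_composition /= andbF.
rewrite mem_cat; apply/orP/idP.
  case=> /mapP[t]; first by rewrite IH => /andP[tp /eqP tm] ->;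
    rewrite /is_composition /= tp tm /= add1n.
  rewrite mem_filter IH => /andP[t0 /andP[tp /eqP tm]] ->.
  case: t t0 tp tm => // k t _ /= /andP[_ tp] tm.
  by rewrite /is_composition /= tp /= addSn tm.
case: s => // -[|[|k]] s //.
  rewrite /is_composition /= => /andP[sp]; rewrite add1n eqSS => sm; left.
  by apply/mapP; exists s; rewrite // IH /is_composition sp.
rewrite /is_composition /= => /andP[sp]; rewrite addSn eqSS => sm; right.
apply/mapP; exists (k.+1 :: s) => //.
by rewrite mem_filter IH /is_composition /= sp.
Qed.

Lemma composition_enum_seq_uniq m : uniq (composition_enum_seq m).
Proof.
elim: m => //= m IH; rewrite cat_uniq map_inj_uniq ?IH; last by move=> s t [].
rewrite map_inj_in_uniq ?filter_uniq //=; last first.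
  move=> s t; rewrite !mem_filter => /andP[+ _] /andP[].
  by case: s t => // a s [|b t] //= _ _ _ [-> ->].
rewrite andbT; apply/hasPn => s /mapP[t]; rewrite mem_filter.
rewrite mem_composition_enum_seq => /andP[t0 /andP[tp _]] ->.
case: t t0 tp => // -[|k] t //= _ _; apply/negP => /mapP[u _].
by case.
Qed.

Definition composition_enum (m : nat) : seq (composition m) :=
  pmap insub (composition_enum_seq m).

Lemma composition_enumP m : Finite.axiom (composition_enum m).
Proof.
move=> x; rewrite count_uniq_mem ?pmap_sub_uniq ?composition_enum_seq_uniq //.
by rewrite mem_pmap_sub mem_composition_enum_seq (valP x).
Qed.

HB.instance Definition _ m :=
  fintype.isFinite.Build (composition m) (@composition_enumP m).

Definition chi_N (x : int) : nat := if (0 < x)%R then 1%N else 0%N.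

(* Positions and parts are numbered from 0: block theta c is the set of the
   positions theta_1 + ... + theta_c + k with 0 <= k < theta_(c+1). *)
Definition block (m : nat) (theta : composition m) (c : nat) : {set 'I_m} :=
  [set j : 'I_m | (sumn (take c theta) <= j < sumn (take c.+1 theta))%N]%SET.

(* (rho j).+1 is the value of the permutation in {1, ..., m}. *)
Definition lambda (m l : nat) (theta : composition m) (rho : 'S_m) (c : nat)
    : nat :=
  (\sum_(j in block theta c) chi_N ((rho j).+1%:Z - l%:Z))%N.

Definition block_sum (m : nat) (i : 'I_m -> nat) (theta : composition m)
    (rho : 'S_m) (c : nat) : nat :=
  (\sum_(j in block theta c) i (rho j))%N.

Definition T_tilde (m l : nat) (i : 'I_m -> nat) (theta : composition m)
    (rho : 'S_m) (c : nat) : az_entry :=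
  if odd (lambda l theta rho c) then barred (block_sum i theta rho c)
  else unbarred (block_sum i theta rho c).

Definition T_check1 (m l : nat) (i : 'I_m -> nat) (q : nat)
    (theta : composition m) (rho : 'S_m) : az_entry :=
  if odd (lambda l theta rho 0) then unbarred (q + block_sum i theta rho 0)%N
  else barred (q + block_sum i theta rho 0)%N.

(* The string (bar q, T~_1, ..., T~_p). *)
Definition string1 (m l : nat) (i : 'I_m -> nat) (q : nat)
    (theta : composition m) (rho : 'S_m) : seq az_entry :=
  barred q :: [seq T_tilde l i theta rho c | c <- iota 0 (size theta)].

(* The string (Tv_1, T~_2, ..., T~_p). *)
Definition string2 (m l : nat) (i : 'I_m -> nat) (q : nat)
    (theta : composition m) (rho : 'S_m) : seq az_entry :=
  T_check1 l i q theta rho ::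
    [seq T_tilde l i theta rho c | c <- iota 1 (size theta).-1].

(* Main.v *)
Require Import Defs.
From HB Require Import structures.
From mathcomp Require Import all_boot all_order all_algebra all_fingroup.
From mathcomp Require Import all_classical all_reals all_analysis.
From mathcomp Require Import ring lra zify.

Set Implicit Arguments.
Unset Strict Implicit.
Unset Printing Implicit Defensive.

Import Order.TTheory GRing.Theory Num.Theory.
Import numFieldNormedType.Exports.

Local Open Scope ring_scope.

(** Since H_n^(i) and -(bar H)_n^(i) are sums of sigma^k / k^i over k <= n, the
    Euler sum is, up to sign, the sum over n of (-1)^n / n^q times a product of
    m such sums. Expanding the product gives one term for every family of m
    indices in [1, n]. Sorting the indices decreasingly and merging equal ones
    yields a composition theta (the multiplicities) and a permutation rho, where
    rho is only determined up to the theta_1! ... theta_p! reorderings inside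
    blocks; this is the weighted sum of nested sums over n >= n_1 > ... > n_p.
    Separating n > n_1 from n = n_1 produces the two strings, so the identity
    holds for partial sums with the same cutoff.
    Convergence: every nested sum is O(sqrt n). Hence a leading exponent at
    least 2 gives absolute convergence by comparison with n^(-3/2), and a
    leading barred 1 is handled by summation by parts. *)

(** * Square-root comparison and alternating series *)

Lemma sqrtr_gt0S (R : realType) (k : nat) : 0 < Num.sqrt k.+1%:R :> R.
Proof. by rewrite sqrtr_gt0 ltr0n. Qed.

(** With r = sqrt n and s = sqrt (n + 1), the relation s^2 - r^2 = 1 turns (s - r)^2 >= 0 into 1/s
    <= 2 (s - r), which telescopes. *)
Lemma sum_invsqrt_le (R : realType) (n : nat) :
  \sum_(k < n) (Num.sqrt k.+1%:R)^-1 <= 2 * Num.sqrt n%:R :> R.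
Proof.
elim: n => [|n IH]; first by rewrite big_ord0 mulr_ge0 ?sqrtr_ge0.
rewrite big_ord_recr /=.
have r0 : 0 <= Num.sqrt n%:R :> R by exact: sqrtr_ge0.
have s0 : 0 < Num.sqrt n.+1%:R :> R by exact: sqrtr_gt0S.
have s2 : Num.sqrt n.+1%:R ^+ 2 = Num.sqrt n%:R ^+ 2 + 1 :> R.
  by rewrite !sqr_sqrtr // -natr1.
apply: le_trans (lerD IH (lexx _)) _.
move: r0 s0 s2; move: (Num.sqrt _) (Num.sqrt _) => s r r0 s0 s2.
rewrite -lerBrDl -(ler_pM2r s0) mulVf ?gt_eqF //.
have : 0 <= (s - r) ^+ 2 by exact: sqr_ge0.
by nra.
Qed.

Lemma is_cvg_series_sqrt_dominated (R : realType) (u : R^nat) (C : R) :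
  (forall k, `|u k| <= C * (Num.sqrt k.+1%:R / k.+1%:R ^+ 2)) ->
  cvgn [normed series u].
Proof.
move=> uC.
pose b k : R := Num.sqrt k.+1%:R / k.+1%:R ^+ 2.
have b0 k : 0 < b k by rewrite divr_gt0 ?sqrtr_gt0S // exprn_gt0.
(* The bound telescopes: x^(-3/2) <= 2 (x - 1)^(-1/2) - 2 x^(-1/2). *)
have bsum n : \sum_(k < n.+1) b k <= 3 - 2 / Num.sqrt n.+1%:R.
  elim: n => [|n IH].
    by rewrite big_ord_recr big_ord0 /= /b sqrtr1 expr1n; lra.
  rewrite big_ord_recr /=; apply: le_trans (lerD IH (lexx _)) _; rewrite /b.
  have r0 : 0 < Num.sqrt n.+1%:R :> R by exact: sqrtr_gt0S.
  have s0 : 0 < Num.sqrt n.+2%:R :> R by exact: sqrtr_gt0S.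
  have r2 : Num.sqrt n.+1%:R ^+ 2 = n.+1%:R :> R by rewrite sqr_sqrtr.
  have s2 : n.+2%:R = Num.sqrt n.+2%:R ^+ 2 :> R by rewrite sqr_sqrtr.
  have s2' : Num.sqrt n.+2%:R ^+ 2 = Num.sqrt n.+1%:R ^+ 2 + 1 :> R.
    by rewrite r2 sqr_sqrtr // -natr1.
  rewrite [X in _ / X ^+ 2]s2.
  move: r0 s0 s2'; move: (Num.sqrt _) (Num.sqrt _) => s r r0 s0 s2'.
  have -> : s / (s ^+ 2) ^+ 2 = (s ^+ 3)^-1 by field; rewrite gt_eqF.
  suff : 0 <= (2 / r - 2 / s) - (s ^+ 3)^-1 by lra.
  have -> : 2 / r - 2 / s - (s ^+ 3)^-1 =
      (2 * s ^+ 2 * (s - r) - r) / (r * s ^+ 3).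
    by field; rewrite !gt_eqF.
  rewrite divr_ge0 ?mulr_ge0 ?exprn_ge0 ?(ltW r0) ?(ltW s0) //.
  (* Multiplying by [s + r] turns the factor [s - r] into s^2 - r^2 = 1. What remains, 2 s^2 >= r s
     + r^2, follows from 2 r s <= r^2 + s^2. *)
  have sr0 : 0 < s + r by lra.
  rewrite -(pmulr_rge0 _ sr0).
  have -> : (s + r) * (2 * s ^+ 2 * (s - r) - r) =
      2 * s ^+ 2 * (s ^+ 2 - r ^+ 2) - r * s - r ^+ 2 by ring.
  rewrite s2'; have := sqr_ge0 (s - r); nra.
have bcvg : cvgn (series b).
  apply: nondecreasing_is_cvgn.
    apply/nondecreasing_seqP => n.
    by rewrite !seriesEnat /= big_nat_recr //= lerDl ltW.
  exists 3 => _ [n _ <-]; rewrite /series /= big_mkord.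
  case: n => [|n]; first by rewrite big_ord0.
  by apply: le_trans (bsum n) _; rewrite gerBl divr_ge0 // sqrtr_ge0.
(* The majorant must be nonnegative, hence the absolute value of [C]. *)
apply: (@series_le_cvg _ _ (fun k => `|C| * b k)) => [k|k|k|].
- exact: normr_ge0.
- by rewrite mulr_ge0 ?normr_ge0 // ltW.
- by apply: le_trans (uC k) _; rewrite ler_wpM2r ?ler_norm // ltW.
- rewrite (_ : (fun k => _) = `|C| *: (b : R^nat)); last exact/funext.
  exact: is_cvg_seriesZ bcvg.
Qed.

(** Leibniz criterion with bounded variation in place of monotonicity. Adding the series to its own
    shift pairs neighbours: twice a partial sum is two boundary terms plus an alternating sum of the
    differences, which converges absolutely. *)
Lemma is_cvg_series_alternating (R : realType) (a : R^nat) :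
  (a @ \oo --> (0 : R))%classic ->
  cvgn [normed series (fun k => a k - a k.+1)] ->
  cvgn (series (fun k => (-1) ^+ k * a k)).
Proof.
move=> a0 da.
pose d k : R := (-1) ^+ k * (a k - a k.+1).
have dcvg : cvgn (series d).
  apply: normed_cvg; rewrite (_ : [normed series d] =
    [normed series (fun k => a k - a k.+1)]) //.
  apply/funext => n; apply: eq_bigr => k _ /=.
  by rewrite /d normrM normrX normrN1 expr1n mul1r.
have sumE N : series (fun k => (-1) ^+ k * a k) N.+1 =
    2^-1 * (a 0%N + (-1) ^+ N * a N + series d N).
  elim: N => [|N IH].
    by rewrite /series /= big_nat1 big_geq // expr0 addr0 mul1r; field.
  by rewrite seriesSr IH seriesSr /d !exprS; field.
have sa0 : ((fun N => (-1) ^+ N * a N) @ \oo --> (0 : R))%classic.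
  apply/cvgr0Pnorm_lt => e e0; move/cvgr0Pnorm_lt : a0 => /(_ _ e0).
  by apply: filterS => k /=; rewrite normrM normrX normrN1 expr1n mul1r.
suff /cvgP : (series (fun k => (-1) ^+ k * a k) @ \oo -->
  (2^-1 * (a 0%N + 0 + limn (series d)) : R))%classic by [].
rewrite -cvg_shiftS /=; under eq_fun do rewrite sumE.
apply: cvgMl_tmp; apply: cvgD => //; apply: cvgD => //; exact: cvg_cst.
Qed.

(** * Nested sums and their convergence *)

Definition az_term (R : realType) (e : az_entry) (k : nat) : R :=
  az_sign R e ^+ k / k%:R ^+ e.1.

(** The outer index is [k.+1] while the inner sum stops at [k]; this makes the indices strictly
    decreasing. *)
Fixpoint nested_sum (R : realType) (w : seq az_entry) (n : nat) : R :=
  if w is e :: w' then \sum_(k < n) az_term R e k.+1 * nested_sum R w' k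
  else 1.

Lemma norm_az_term_le (R : realType) (e : az_entry) (s k : nat) :
  (s <= e.1)%N -> `|az_term R e k.+1| <= (k.+1%:R ^+ s)^-1.
Proof.
move=> se; rewrite normrM normrX normfV normrX normr_nat.
have -> : `|az_sign R e| = 1.
  by rewrite /az_sign; case: e.2; rewrite ?normrN1 ?normr1.
rewrite expr1n mul1r lef_pV2 ?posrE ?exprn_gt0 //.
by rewrite ler_weXn2l // ler1n.
Qed.

(* A power of n is a self-reproducing bound: if |Z(w', k)| <= C sqrt (k + 1),
   summing against 1 / (k + 1) gives 2 C sqrt n. *)
Lemma nested_sum_bounded (R : realType) (w : seq az_entry) :
  all (fun e => 0 < e.1)%N w ->
  exists2 C : R, 0 <= C & forall n, `|nested_sum R w n| <= C * Num.sqrt n.+1%:R.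
Proof.
elim: w => [_|e w IH /= /andP[e0 /IH[C C0 wC]]].
  by exists 1 => // n; rewrite /= normr1 mul1r -{1}sqrtr1 ler_sqrt // ler1n.
exists (2 * C) => [|n]; first by rewrite mulr_ge0.
apply: (@le_trans _ _ (\sum_(k < n) C * (Num.sqrt k.+1%:R)^-1)); last first.
  rewrite -mulr_sumr (mulrC 2) -mulrA ler_wpM2l //.
  apply: le_trans (sum_invsqrt_le _ n) _.
  by rewrite ler_wpM2l // ler_sqrt // ler_nat.
apply: le_trans (ler_norm_sum _ _ _) _; apply: ler_sum => k _.
rewrite normrM.
apply: le_trans (ler_pM _ _ (norm_az_term_le R k e0) (wC k)) _ => //.
rewrite expr1 mulrCA ler_wpM2l // -{1}(@sqr_sqrtr R k.+1%:R) //.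
by rewrite expr2 invfM -mulrA mulVf ?mulr1 // gt_eqF // sqrtr_gt0S.
Qed.

Lemma nested_sum_cons (R : realType) (e : az_entry) (w : seq az_entry) :
  nested_sum R (e :: w) = series (fun k => az_term R e k.+1 * nested_sum R w k).
Proof. by apply/funext => n; rewrite /series /= big_mkord. Qed.

Lemma cvgn_invsqrt (R : realType) (C : R) (a : R^nat) :
  (forall k, `|a k| <= C * (Num.sqrt k.+1%:R)^-1) ->
  (a @ \oo --> (0 : R))%classic.
Proof.
move=> aC; apply/cvgr0Pnorm_lt => e e0.
near=> k; apply: le_lt_trans (aC k) _.
rewrite ltr_pdivrMr ?sqrtr_gt0S // -ltr_pdivrMl //.
apply: le_lt_trans (ler_norm _) _; rewrite -sqrtr_sqr ltr_sqrt ?ltr0n //.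
apply: (@lt_le_trans _ _ k%:R); last by rewrite ler_nat.
near: k; exact: nbhs_infty_gtr.
Unshelve. all: by end_near. Qed.

Lemma is_cvg_nested_sum (R : realType) (e : az_entry) (w : seq az_entry) :
  (0 < e.1)%N -> e.2 || (1 < e.1)%N -> all (fun e => 0 < e.1)%N w ->
  cvgn (nested_sum R (e :: w)).
Proof.
move=> e0 e12 w0; rewrite nested_sum_cons.
have [C C0 wC] := nested_sum_bounded R w0.
have [e2|] := boolP (1 < e.1)%N.
  apply: normed_cvg; apply: (@is_cvg_series_sqrt_dominated _ _ C) => k.
  rewrite normrM mulrA [X in _ <= X]mulrC ler_pM //.
  exact: norm_az_term_le.
rewrite -leqNgt => e1.
have {e0 e1} e1 : e.1 = 1%N by apply/eqP; rewrite eqn_leq e1.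
move: e12; rewrite e1 orbF => e2.
(* A leading barred 1 contributes (-1)^(k+1) / (k + 1), so the general term is minus
   [(-1) ^+ k * a k]. *)
pose a k : R := nested_sum R w k / k.+1%:R.
suff : cvgn (series (fun k => (-1) ^+ k * a k)).
  move=> h; rewrite (_ : (fun k => _) = -1 *: (fun k => (-1) ^+ k * a k)).
    exact: is_cvg_seriesZ.
  apply/funext => k; rewrite /az_term /az_sign e1 e2 /a exprS expr1.
  by rewrite -[RHS]/(-1 * _); ring.
apply: is_cvg_series_alternating.
  apply: (@cvgn_invsqrt _ C) => k; rewrite normrM normfV normr_nat.
  rewrite ler_pdivrMr ?ltr0n // -mulrA -{2}(@sqr_sqrtr R k.+1%:R) //.
  by rewrite expr2 [_^-1 * _]mulrA mulVf ?mul1r ?wC // gt_eqF // sqrtr_gt0S.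
(* One step of [nested_sum R w] adds a single term, in absolute value at most 1/(k + 1) times a
   shorter nested sum; for empty [w] the difference is 0. *)
have [D D0 dw] : exists2 D : R, 0 <= D & forall k,
    `|nested_sum R w k - nested_sum R w k.+1| <= D * Num.sqrt k.+1%:R / k.+1%:R.
  case: w w0 {C C0 wC a}
    => [_|f w /= /andP[f0 /(nested_sum_bounded R)[D D0 wD]]].
    by exists 0 => // k; rewrite /= subrr normr0 !mul0r.
  exists D => // k; rewrite big_ord_recr /= opprD addNKr normrN normrM mulrC.
  by rewrite ler_pM // -[k.+1%:R]expr1 norm_az_term_le.
apply: (@is_cvg_series_sqrt_dominated _ _ (C + D)) => k.
set x : R := k.+1%:R; have x0 : 0 < x by rewrite ltr0n.
have x1 : 0 < x + 1 by lra.
(* Product rule for differences, using 1/x - 1/(x + 1) = 1/(x (x + 1)); both parts are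
   O(x^(-3/2)). *)
have -> : a k - a k.+1 = nested_sum R w k / (x * (x + 1)) +
    (nested_sum R w k - nested_sum R w k.+1) / (x + 1).
  by rewrite /a -[k.+2%:R]natr1 -/x; field; rewrite !gt_eqF.
apply: le_trans (ler_normD _ _) _; rewrite !normrM !normfV mulrDl.
rewrite [`|x * _|]gtr0_norm ?mulr_gt0 // [`|x + 1|]gtr0_norm //.
apply: lerD.
  rewrite mulrA; apply: ler_pM => //; first by rewrite invr_ge0 ltW // mulr_gt0.
  by rewrite lef_pV2 ?posrE ?mulr_gt0 ?exprn_gt0 // expr2 ler_pM2l //; lra.
rewrite expr2 invfM !mulrA; apply: ler_pM => //; first by rewrite invr_ge0 ltW.
by rewrite lef_pV2 ?posrE //; lra.
Qed.

(** * Partial sums of multiple zeta values as nested sums *)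

Definition fcons (T : finType) (k : nat) (x : T) (g : {ffun 'I_k -> T}) :
    {ffun 'I_k.+1 -> T} :=
  [ffun a => if unlift ord0 a is Some b then g b else x].

Lemma fcons0 (T : finType) (k : nat) (x : T) (g : {ffun 'I_k -> T}) :
  fcons x g ord0 = x.
Proof. by rewrite ffunE unlift_none. Qed.

Lemma fcons_lift (T : finType) (k : nat) (x : T) (g : {ffun 'I_k -> T}) b :
  fcons x g (lift ord0 b) = g b.
Proof. by rewrite ffunE liftK. Qed.

Lemma codom_fcons (T : finType) (k : nat) (x : T) (g : {ffun 'I_k -> T}) :
  codom (fcons x g) = x :: codom g.
Proof.
rewrite /codom /image_mem !enumT -!enumT enum_ordSl /= fcons0 -map_comp.
by congr (_ :: _); apply: eq_map => b; rewrite /= fcons_lift.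
Qed.

(** Provides the recursion on the first entry, both for decreasing index families and for
    arrangements. *)
Lemma big_fcons (V : nmodType) (T : finType) (k : nat)
    (P : pred {ffun 'I_k.+1 -> T}) (F : {ffun 'I_k.+1 -> T} -> V) :
  \sum_(f | P f) F f = \sum_(x : T) \sum_(g | P (fcons x g)) F (fcons x g).
Proof.
rewrite pair_big_dep (reindex (fun p => fcons p.1 p.2)) //=.
exists (fun f => (f ord0, [ffun b => f (lift ord0 b)])) => [[x g]|f] _ /=.
  rewrite fcons0; congr pair; apply/ffunP => b.
  by rewrite ffunE fcons_lift.
apply/ffunP => a; rewrite ffunE; case: unliftP => [b|] -> //.
by rewrite ffunE.
Qed.

(** The cutoff [n] is kept apart from the bound [N] of the type, so that it can drop in an induction
    while the type stays fixed. *)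
Definition decreasing_below (k N n : nat) (f : {ffun 'I_k -> 'I_N.+1}) : bool :=
  [forall a, 0 < f a <= n]%N &&
  [forall a : 'I_k, forall b : 'I_k, (a < b)%N ==> (f b < f a)%N].

Lemma decreasing_below_fcons (k N n : nat) (x : 'I_N.+1)
    (g : {ffun 'I_k -> 'I_N.+1}) :
  decreasing_below n (fcons x g) = (0 < x <= n)%N && decreasing_below x.-1 g.
Proof.
apply/idP/idP
  => [/andP[/forallP fn /forallP fd]|/and3P[xn /forallP gn /forallP gd]].
  have := fn ord0; rewrite fcons0 => /andP[x0 ->]; rewrite x0 /=.
  apply/andP; split; apply/forallP => a.
    have := fn (lift ord0 a); rewrite fcons_lift => /andP[-> _].
    have /forallP/(_ (lift ord0 a)) := fd ord0.
    by rewrite fcons0 fcons_lift; case: (x : nat) x0.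
  apply/forallP => b; have /forallP/(_ (lift ord0 b)) := fd (lift ord0 a).
  by rewrite !fcons_lift !lift0 ltnS.
case/andP: (xn) => x0 xn'; apply/andP; split; apply/forallP => a.
  case: (unliftP ord0 a) => [a'|] ->; rewrite ?fcons0 ?fcons_lift //.
  by have /= /andP[-> ?] := gn a'; lia.
apply/forallP => b; apply/implyP.
case: (unliftP ord0 a) => [a'|] ->; case: (unliftP ord0 b) => [b'|] -> //;
  rewrite ?fcons0 ?fcons_lift ?lift0 //= ?ltnS.
  by move=> ab; have /forallP/(_ b')/implyP := gd a'; apply.
by move=> _; have /= := gn b'; lia.
Qed.

Lemma sum_decreasing_below (R : realType) (w : seq az_entry) (N n : nat) :
  (n <= N)%N ->
  \sum_(f : {ffun 'I_(size w) -> 'I_N.+1} | decreasing_below n f)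
    \prod_(a < size w) az_term R (nth (unbarred 0) w a) (f a) =
  nested_sum R w n.
Proof.
elim: w n => [|e w IH] n nN /=.
  rewrite (eq_bigl (pred1 [ffun=> ord0])) => [|f].
    by rewrite big_pred1_eq big_ord0.
  have -> : f = [ffun=> ord0] by apply/ffunP; case.
  rewrite /= eqxx; apply/andP; split; apply/forallP; by case.
rewrite big_fcons.
transitivity (\sum_(x : 'I_N.+1)
    \sum_(g : {ffun 'I_(size w) -> 'I_N.+1} |
      (0 < x <= n)%N && decreasing_below x.-1 g)
    az_term R e x * \prod_(a < size w) az_term R (nth (unbarred 0) w a) (g a)).
  apply: eq_bigr => x _; apply: eq_big => [g|g _].
    exact: decreasing_below_fcons.
  rewrite big_ord_recl fcons0; congr (_ * _); apply: eq_bigr => a _.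
  by rewrite fcons_lift.
transitivity (\sum_(x < N.+1 | (0 < x <= n)%N)
    az_term R e x * nested_sum R w x.-1).
  rewrite [RHS]big_mkcond; apply: eq_bigr => x _.
  case: ifP => [xn|_]; last first.
    by rewrite big_pred0.
  by rewrite -mulr_sumr IH //; lia.
(* The index 0 contributes nothing; the others are shifted to [k.+1], and the sum up to [n] is
   padded with zeros up to [N]. *)
rewrite big_mkcond big_ord_recl /= add0r.
rewrite (big_ord_widen N (fun k => az_term R e k.+1 * nested_sum R w k)) //.
by rewrite [RHS]big_mkcond.
Qed.

Lemma amzv_partial_sumE (R : realType) (w : seq az_entry) :
  amzv_partial_sum R w = nested_sum R w.
Proof.
apply/funext => n; rewrite -(sum_decreasing_below R w (leqnn n)).
apply: eq_bigl => f; congr andb; apply: eq_forallb => a.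
by rewrite leq_ord andbT.
Qed.

(** * Products of sums as sums over orderings *)

Lemma prodrD_subset (R : comPzSemiRingType) (T : finType) (A : {set T})
    (F G : T -> R) :
  \prod_(j in A) (F j + G j) =
  \sum_(B : {set T} | B \subset A)
    (\prod_(j in B) F j) * \prod_(j in A :\: B) G j.
Proof.
(* Extending by 0 and 1 outside [A] gives a product over all of [T]; the 0 kills every subset not
   contained in [A]. *)
pose F' j := if j \in A then F j else 0.
pose G' j := if j \in A then G j else 1.
transitivity (\prod_j (F' j + G' j)).
  rewrite [LHS]big_mkcond; apply: eq_bigr => j _.
  by rewrite /F' /G'; case: ifP; rewrite ?add0r.
rewrite bigA_distr [RHS]big_mkcond; apply: eq_bigr => B _.
case: ifP => [BA|/negbT/fintype.subsetPn[j jB jA]]; last first.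
  by rewrite (bigD1 j) //= jB /F' (negPf jA) mul0r.
rewrite [X in X * _]big_mkcond [X in _ * X]big_mkcond -big_split /=.
apply: eq_bigr => j _; rewrite !inE /F' /G'.
have [jB|_] /= := boolP (j \in B).
  by rewrite (fintype.subsetP BA) // mulr1.
by rewrite mul1r.
Qed.

(** For [k = #|A|] these are the orderings of [A], and for the full set of ['I_m] the permutations.
    Passing to [codom] lets the summand use list operations. *)
Definition arrangement_sum (V : nmodType) (T : finType) (k : nat) (A : {set T})
    (H : seq T -> V) : V :=
  \sum_(f : {ffun 'I_k -> T} | uniq (codom f) && all (mem A) (codom f))
    H (codom f).

Lemma arrangement_sum0 (V : nmodType) (T : finType) (A : {set T})
    (H : seq T -> V) :
  arrangement_sum 0 A H = H [::].
Proof.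
have cod0 (f : {ffun 'I_0 -> T}) : codom f = [::].
  by apply: size0nil; rewrite size_codom card_ord.
have [f0 _] : exists f : {ffun 'I_0 -> T}, true.
  by exists [ffun a : 'I_0 => False_rect T (notF (ltn_ord a))].
rewrite /arrangement_sum (eq_bigl (pred1 f0)) => [|f].
  by rewrite big_pred1_eq cod0.
rewrite cod0 /=; apply/esym/eqP/ffunP; by case.
Qed.

Lemma arrangement_sumS (V : nmodType) (T : finType) (k : nat) (A : {set T})
    (H : seq T -> V) :
  arrangement_sum k.+1 A H =
  \sum_(a in A) arrangement_sum k (A :\ a)%SET (fun s => H (a :: s)).
Proof.
rewrite /arrangement_sum big_fcons [RHS]big_mkcond; apply: eq_bigr => a _.
have E (g : {ffun 'I_k -> T}) :
    uniq (codom (fcons a g)) && all (mem A) (codom (fcons a g)) =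
    (a \in A) && (uniq (codom g) && all (mem (A :\ a)%SET) (codom g)).
  rewrite codom_fcons /=.
  have -> : all (mem (A :\ a)%SET) (codom g) =
      (a \notin codom g) && all (mem A) (codom g).
    elim: (codom g) => //= x s ->; rewrite inE in_cons negb_or eq_sym.
    by rewrite !inE; case: (x == a) => //=; case: (a \in s); case: (x \in A).
  by case: (a \in A); case: uniq; case: (a \in codom g) => //=; rewrite ?andbF.
case: ifP => aA; last by rewrite big_pred0 // => g; rewrite E aA.
by apply: eq_big => [g|g _]; rewrite ?E ?aA // codom_fcons.
Qed.

Lemma eq_arrangement_sum (V : nmodType) (T : finType) (k : nat) (A : {set T})
    (H1 H2 : seq T -> V) :
  (forall s, size s = k -> H1 s = H2 s) ->
  arrangement_sum k A H1 = arrangement_sum k A H2.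
Proof.
by move=> H12; apply: eq_bigr => f _; apply: H12; rewrite size_codom card_ord.
Qed.

Lemma arrangement_sumZ (R : pzRingType) (T : finType) (k : nat) (A : {set T})
    (c : R) (H : seq T -> R) :
  arrangement_sum k A (fun s => c * H s) = c * arrangement_sum k A H.
Proof. by rewrite /arrangement_sum mulr_sumr. Qed.

Lemma arrangement_sum_sum (V : nmodType) (T I : finType) (k : nat)
    (A : {set T}) (H : I -> seq T -> V) :
  arrangement_sum k A (fun s => \sum_i H i s) =
  \sum_i arrangement_sum k A (H i).
Proof. by rewrite /arrangement_sum exchange_big. Qed.

(* Summing out the order of the first t entries leaves the set B they form,
   each counted t! times. *)
Lemma arrangement_sum_take (R : comPzRingType) (T : finType) (t k : nat)
    (A : {set T}) (y : T -> R) (H : seq T -> R) :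
  arrangement_sum (t + k) A
    (fun s => (\prod_(j <- take t s) y j) * H (drop t s)) =
  t`!%:R * \sum_(B : {set T} | (B \subset A) && (#|B| == t))
    (\prod_(j in B) y j) * arrangement_sum k (A :\: B)%SET H.
Proof.
elim: t A => [|t IH] A.
  rewrite mul1r (big_pred1 finset.set0) => [|B /=]; last first.
    rewrite cards_eq0; have [->|_] := eqVneq B finset.set0; last exact: andbF.
    by rewrite finset.sub0set.
  rewrite finset.big_set0 mul1r finset.setD0; apply: eq_arrangement_sum => s _.
  by rewrite take0 drop0 big_nil mul1r.
rewrite addSn arrangement_sumS.
transitivity (\sum_(a in A)
    \sum_(B : {set T} | (B \subset A :\ a)%SET && (#|B| == t))
    t`!%:R * ((\prod_(j in (a |: B)%SET) y j) *
              arrangement_sum k (A :\: (a |: B))%SET H)).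
  apply: eq_bigr => a aA.
  transitivity (y a * arrangement_sum (t + k) (A :\ a)%SET
      (fun s => (\prod_(j <- take t s) y j) * H (drop t s))).
    rewrite -arrangement_sumZ; apply: eq_bigr => f _.
    by rewrite /= big_cons mulrA.
  rewrite IH mulrCA mulr_sumr mulr_sumr; apply: eq_bigr => B /andP[BA _].
  have aB : a \notin B.
    by apply/negP => /(fintype.subsetP BA); rewrite !inE eqxx.
  by rewrite finset.big_setU1 //= -mulrA finset.setDDl.
pose Psi (C : {set T}) :=
  (\prod_(j in C) y j) * arrangement_sum k (A :\: C)%SET H.
(* Double counting of the pairs of [C = a |: B] and its first element [a]: each [C] occurs t + 1
   times, and (t + 1) t! = (t + 1)!. *)
transitivity (\sum_(C : {set T} | (C \subset A) && (#|C| == t.+1))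
    \sum_(a in C) t`!%:R * Psi C); last first.
  rewrite mulr_sumr; apply: eq_bigr => C /andP[_ /eqP cC].
  by rewrite sumr_const cC factS natrM -mulrA [RHS]mulr_natl.
rewrite [RHS](exchange_big_dep (mem A)) /=; last first.
  by move=> C a /andP[/fintype.subsetP CA _]; exact: CA.
apply: eq_bigr => a aA.
rewrite [RHS](reindex_onto (fun B => a |: B)%SET (fun C => C :\ a)%SET) /=;
  last first.
  by move=> C /andP[_ aC]; rewrite finset.setD1K.
apply: eq_bigl => B; rewrite finset.setU11 andbT.
have [aB|aB] := boolP (a \in B).
  have /negPf -> : ~~ (B \subset A :\ a)%SET.
    by apply/negP => /fintype.subsetP/(_ a aB); rewrite !inE eqxx.
  apply/esym/negbTE; rewrite negb_and orbC; apply/orP; left.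
  by apply/eqP => /(congr1 (fun C : {set T} => a \in C)); rewrite aB !inE eqxx.
rewrite finset.setU1K // eqxx andbT finset.cardsU1 aB add1n eqSS.
rewrite finset.subsetD1 aB andbT.
by rewrite finset.subUset finset.sub1set aA.
Qed.

(* The sum over weakly decreasing index sequences for s: the entries whose
   index is n' + 1 form an initial segment of s. *)
Fixpoint weak_sum (R : fieldType) (T : Type) (y : T -> nat -> R) (n : nat)
    (s : seq T) : R :=
  if n is n'.+1 then
    \sum_(t < (size s).+1)
      t`!%:R^-1 * ((\prod_(j <- take t s) y j n') * weak_sum y n' (drop t s))
  else (nilp s)%:R.

(** Induction on [n]: expanding the product selects the set [B] of factors that use the last index.
    An ordering lists [B] first in t! ways, with t = #|B|, which cancels the weight in
    [weak_sum]. *)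
Lemma arrangement_weak_sum (R : numFieldType) (T : finType)
    (y : T -> nat -> R) (n : nat) (A : {set T}) :
  arrangement_sum #|A| A (weak_sum y n) = \prod_(j in A) \sum_(k < n) y j k.
Proof.
elim: n A => [|n IH] A.
  have [->|[a aA]] := finset.set_0Vmem A.
    by rewrite finset.cards0 finset.big_set0 arrangement_sum0.
  rewrite (bigD1 a) //= big_ord0 mul0r (cardsD1 a) aA arrangement_sumS.
  by rewrite big1 // => b _; rewrite /arrangement_sum big1.
rewrite (eq_arrangement_sum _ (H2 := fun s => \sum_(t < #|A|.+1)
    t`!%:R^-1 * ((\prod_(j <- take t s) y j n) * weak_sum y n (drop t s))));
  last first.
  by move=> s sA; rewrite /= sA.
rewrite arrangement_sum_sum.
under [RHS]eq_bigr => j _ do rewrite big_ord_recr /= addrC.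
rewrite prodrD_subset.
(* Only subsets of [A] occur, so [inord] returns the true cardinal. *)
rewrite (partition_big (fun B : {set T} => inord #|B| : 'I_#|A|.+1) predT) //=.
apply: eq_bigr => t _; rewrite arrangement_sumZ.
have tA : (t <= #|A|)%N by rewrite -ltnS ltn_ord.
have := arrangement_sum_take t (#|A| - t) A (y^~ n) (weak_sum y n).
rewrite subnKC // => ->; rewrite mulrA mulVf ?mul1r; last first.
  by rewrite pnatr_eq0 -lt0n fact_gt0.
apply: eq_big => [B|B /andP[BA /eqP cB]].
  have [BA|//] := boolP (B \subset A).
  by rewrite -val_eqE /= inordK // ltnS subset_leq_card.
by rewrite -IH cardsD (finset.setIidPr BA) cB.
Qed.

(** * Compositions and merging of equal indices *)

Lemma sum_composition_enumS (V : nmodType) (m : nat) (phi : seq nat -> V) :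
  \sum_(s <- composition_enum_seq m.+1) phi s =
  \sum_(t < m.+1) \sum_(s <- composition_enum_seq (m - t)) phi (t.+1 :: s).
Proof.
elim: m phi => [|m IH] phi.
  by rewrite big_ord_recl big_ord0 /= !big_seq1 addr0.
(* Prepending a 1 gives the case [t = 0]; incrementing the first part shifts the induction
   hypothesis to the positive [t]. *)
rewrite [composition_enum_seq m.+2]/= -/(composition_enum_seq m.+1).
rewrite big_cat !big_map big_ord_recl subn0; congr (_ + _).
rewrite big_filter big_mkcond.
rewrite (IH (fun s =>
  if s != [::] then phi ((head 0 s).+1 :: behead s)%N else 0)).
by apply: eq_bigr => t _; rewrite lift0 subSS.
Qed.

Section merge_entries.
Variables (R : realType) (T : Type) (e : T -> az_entry).

(** Entries sharing one index: exponents add up, and signs multiply, so only the parity of the bars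
    survives. *)
Definition merge_entries (b : seq T) : az_entry :=
  ((\sum_(j <- b) (e j).1)%N, odd (\sum_(j <- b) (e j).2)).

Lemma az_term_merge_entries (b : seq T) (k : nat) :
  az_term R (merge_entries b) k = \prod_(j <- b) az_term R (e j) k.
Proof.
rewrite /merge_entries; elim: b => [|j b IH].
  by rewrite !big_nil /az_term /az_sign /= expr1n divr1.
rewrite !big_cons -IH /az_term /az_sign /= oddD oddb exprD invfM.
set p := odd _; set x := k%:R.
have -> : (if (e j).2 (+) p then -1 else 1 : R) =
    (if (e j).2 then -1 else 1) * (if p then -1 else 1).
  by case: (e j).2; case: p; rewrite /= ?mulrNN ?mulr1 ?mul1r.
by rewrite exprMn mulrACA.
Qed.

(** [theta] lists the lengths of the runs of equal indices along [s]; each run becomes one entry of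
    a strict nested sum. *)
Definition merged_sum (s : seq T) (n : nat) : R :=
  \sum_(theta <- composition_enum_seq (size s))
    (\prod_(t <- theta) t`!)%N%:R^-1 *
    nested_sum R [seq merge_entries b | b <- reshape theta s] n.

Lemma merged_sum_recl (s : seq T) (n : nat) : ~~ nilp s ->
  merged_sum s n =
  \sum_(t < size s) t.+1`!%:R^-1 * \sum_(k < n)
    (\prod_(j <- take t.+1 s) az_term R (e j) k.+1) *
    merged_sum (drop t.+1 s) k.
Proof.
rewrite /merged_sum; case sE: (size s) => [|m].
  by rewrite /nilp sE.
move=> _; rewrite sum_composition_enumS; apply: eq_bigr => t _.
rewrite size_drop sE subSS.
under [X in _ = _ * X]eq_bigr => k _ do rewrite mulr_sumr.
rewrite exchange_big mulr_sumr; apply: eq_bigr => theta _ /=.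
rewrite big_cons natrM invfM -mulrA; congr (_ * _); rewrite mulr_sumr.
by apply: eq_bigr => k _; rewrite az_term_merge_entries mulrCA.
Qed.

(** Both sides obey the same recursion in [n]: the new index is used by no entry, which leaves the
    old sum, or by a first run of [t.+1] entries. *)
Lemma weak_sumE (s : seq T) (n : nat) :
  weak_sum (fun j k => az_term R (e j) k.+1) n s = merged_sum s n.
Proof.
have nilE m : merged_sum [::] m = 1.
  by rewrite /merged_sum /= big_seq1 big_nil invr1 mul1r.
elim: n s => [|n IH] s.
  have [/nilP->|s0] := boolP (nilp s); first by rewrite nilE.
  rewrite merged_sum_recl //= (negPf s0) big1 // => t _.
  by rewrite big_ord0 mulr0.
rewrite /=; under eq_bigr => t _ do rewrite IH.
have [/nilP->|s0] := boolP (nilp s).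
  by rewrite big_ord_recl big_ord0 /= big_nil !nilE addr0 invr1 !mul1r.
rewrite big_ord_recl /= take0 drop0 big_nil invr1 !mul1r !merged_sum_recl //.
rewrite -big_split /=; apply: eq_bigr => t _.
by rewrite big_ord_recr mulrDr.
Qed.

End merge_entries.

(** * Permutations, blocks and argument strings *)

Lemma arrangement_sum_setT (V : nmodType) (m : nat) (H : seq 'I_m -> V) :
  arrangement_sum m finset.setT H = \sum_(rho : 'S_m) H (codom rho).
Proof.
have cE (rho : 'S_m) : codom (val rho) = codom rho.
  exact: (congr1 (fun f : 'I_m -> 'I_m => codom f) (pvalE rho)).
(* A duplicate-free codomain means injectivity, so [insubd] never returns its default on the
   summation range. *)
rewrite /arrangement_sum (reindex_onto val (insubd (1%g : 'S_m))) => [|f] /=.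
  apply: eq_big => [rho|rho _]; rewrite cE // valKd eqxx andbT.
  rewrite map_inj_uniq ?enum_uniq //; last exact: perm_inj.
  by apply/allP => x _; rewrite inE.
move=> /andP[uf _]; apply: insubdK; exact: uf.
Qed.

Lemma sum_composition (V : nmodType) (m : nat) (phi : seq nat -> V) :
  \sum_(theta : composition m) phi theta =
  \sum_(s <- composition_enum_seq m) phi s.
Proof.
have /(perm_big _) <- : perm_eq
    [seq val theta | theta <- enum {: composition m}]
    (composition_enum_seq m).
  apply: uniq_perm; first by rewrite (map_inj_uniq val_inj) enum_uniq.
    exact: composition_enum_seq_uniq.
  move=> s; rewrite mem_composition_enum_seq; apply/mapP/idP.
    by move=> [theta _ ->]; exact: valP.
  by move=> sm; exists (Composition sm); rewrite ?mem_enum.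
by rewrite big_map big_enum.
Qed.

Section blocks.
Variables (m : nat) (theta : composition m) (rho : 'S_m).

Lemma size_codom_perm : size (codom rho) = m.
Proof. by rewrite size_codom card_ord. Qed.

Lemma sumn_composition : sumn theta = m.
Proof. by have /andP[_ /eqP] := valP theta. Qed.

Lemma size_composition_gt0 : (0 < m)%N -> (0 < size theta)%N.
Proof.
by have := sumn_composition; case: (theta : seq nat) => //= <-.
Qed.

(** Reading [rho] as the word [codom rho], a block of positions is exactly the piece that [reshape]
    cuts out. *)
Lemma sum_block (F : 'I_m -> nat) (c : nat) : (c < size theta)%N ->
  (\sum_(j in block theta c) F (rho j) =
   \sum_(x <- nth [::] (reshape theta (codom rho)) c) F x)%N.
Proof.
move=> ct; rewrite nth_reshape /codom /image_mem -map_drop -map_take big_map.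
rewrite -[LHS]big_enum /=; apply: perm_big; apply: uniq_perm.
- exact: enum_uniq.
- by rewrite take_uniq // drop_uniq // enum_uniq.
move=> x; rewrite mem_enum inE -[RHS](mem_map val_inj) map_take map_drop.
rewrite val_enum_ord drop_iota take_iota mem_iota (take_nth 0%N) // sumn_rcons.
by have := ltn_ord x; case: x => x /= _; lia.
Qed.

(** Used for the sign: the sum of all lambda_c counts the barred indices, whatever [theta] and [rho]
    are. *)
Lemma sum_reshape (F : 'I_m -> nat) :
  (\sum_(c < size theta)
     \sum_(x <- nth [::] (reshape theta (codom rho)) c) F x =
   \sum_j F j)%N.
Proof.
have -> : (\sum_j F j = \sum_(x <- codom rho) F x)%N.
  rewrite /codom /image_mem big_map big_enum.
  by rewrite [LHS](reindex_inj (@perm_inj _ rho)); apply: eq_bigl.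
rewrite -[in RHS](@reshapeKr _ theta (codom rho)).
  by rewrite big_flatten (big_nth [::]) size_reshape big_mkord.
by rewrite sumn_composition size_codom_perm.
Qed.

Lemma reshape_neq0 : all (fun b => ~~ nilp b) (reshape theta (codom rho)).
Proof.
have /andP[tp _] := valP theta.
have := tp; rewrite -[X in all _ X -> _](@reshapeKl _ theta (codom rho));
  last first.
  by rewrite sumn_composition size_codom_perm.
by rewrite all_map; congr is_true; apply: eq_all => b /=; rewrite lt0n.
Qed.

End blocks.

Section strings.
Variables (m l : nat) (i : 'I_m -> nat).

Definition index_entry (j : 'I_m) : az_entry := (i j, (l <= j)%N).

Lemma lambdaE (theta : composition m) (rho : 'S_m) (c : nat) :
  (c < size theta)%N ->
  lambda l theta rho c =
  (\sum_(x <- nth [::] (reshape theta (codom rho)) c) (l <= x))%N.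
Proof.
move=> ct; rewrite -(sum_block rho (fun x => (l <= x)%N : nat)) //.
(* With numbering from 0, [(rho j).+1 - l] is positive exactly when [l <= rho j]. *)
apply: eq_bigr => j _; rewrite /chi_N subr_gt0 ltz_nat ltnS.
by case: ifP.
Qed.

Lemma T_tilde_merge (theta : composition m) (rho : 'S_m) (c : nat) :
  (c < size theta)%N ->
  T_tilde l i theta rho c =
  merge_entries index_entry (nth [::] (reshape theta (codom rho)) c).
Proof.
move=> ct; rewrite /T_tilde /merge_entries lambdaE // /block_sum sum_block //.
by case: odd.
Qed.

Lemma string_merge (theta : composition m) (rho : 'S_m) :
  [seq T_tilde l i theta rho c | c <- iota 0 (size theta)] =
  [seq merge_entries index_entry b | b <- reshape theta (codom rho)].
Proof.
apply: (@eq_from_nth _ (unbarred 0)).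
  by rewrite !size_map size_iota size_reshape.
move=> c; rewrite size_map size_iota => ct.
rewrite (nth_map 0%N) ?size_iota // nth_iota // (nth_map [::]) ?size_reshape //.
exact: T_tilde_merge.
Qed.

Lemma all_merge_gt0 (bs : seq (seq 'I_m)) : (forall j, 0 < i j)%N ->
  all (fun b => ~~ nilp b) bs ->
  all (fun e => 0 < e.1)%N [seq merge_entries index_entry b | b <- bs].
Proof.
move=> i0; rewrite all_map; apply: sub_all => -[|x b] //= _.
by rewrite big_cons /= addn_gt0 i0.
Qed.

End strings.

(** * The Euler sum at a finite cutoff and in the limit *)

Lemma harmonic_numberE (R : realType) (n r : nat) :
  harmonic_number R n r = \sum_(k < n) az_term R (unbarred r) k.+1.
Proof.
rewrite /harmonic_number big_add1 big_mkord; apply: eq_bigr => k _.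
by rewrite /az_term /az_sign /= expr1n.
Qed.

Lemma alt_harmonic_numberE (R : realType) (n r : nat) :
  alt_harmonic_number R n r = - \sum_(k < n) az_term R (barred r) k.+1.
Proof.
rewrite /alt_harmonic_number big_add1 big_mkord -sumrN; apply: eq_bigr => k _.
by rewrite /az_term /az_sign /= subn1 /= exprS mulN1r mulNr opprK.
Qed.

(** Each barred factor gives one minus sign, since (-1)^(k-1) = -(-1)^k; the outer (-1)^(n-1) gives
    the extra one. *)
Lemma alt_euler_partial_sumE (R : realType) (m l : nat) (i : 'I_m -> nat)
    (q N : nat) :
  alt_euler_partial_sum R l i q N =
  (-1) ^+ ((\sum_(j < m) (l <= j)) + 1)%N *
  \sum_(k < N) az_term R (barred q) k.+1 *
    \prod_j \sum_(h < k.+1) az_term R (index_entry l i j) h.+1.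
Proof.
rewrite /alt_euler_partial_sum big_add1 big_mkord mulr_sumr.
apply: eq_bigr => k _.
pose X j := \sum_(h < k.+1) az_term R (index_entry l i j) h.+1.
rewrite -[\prod_j _]/(\prod_j X j).
have -> : \prod_(j < m | (j < l)%N) harmonic_number R k.+1 (i j) =
    \prod_(j < m | (j < l)%N) X j.
  apply: eq_bigr => j jl; rewrite harmonic_numberE; apply: eq_bigr => h _.
  by rewrite /index_entry leqNgt jl.
have -> : \prod_(j < m | (l <= j)%N) alt_harmonic_number R k.+1 (i j) =
    (-1) ^+ (\sum_(j < m) (l <= j))%N * \prod_(j < m | (l <= j)%N) X j.
  rewrite expr_sum [X in X * _](bigID (fun j : 'I_m => (l <= j)%N)) /=.
  rewrite [X in _ * X * _]big1 ?mulr1 => [|j /negPf -> //].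
  rewrite -big_split /=; apply: eq_bigr => j lj.
  rewrite alt_harmonic_numberE lj expr1 mulN1r; congr (- _).
  by apply: eq_bigr => h _; rewrite /index_entry lj.
rewrite [\prod_j X j](bigID (fun j : 'I_m => (j < l)%N)) /=.
under [X in _ = _ * (_ * (_ * X))]eq_bigl => j do rewrite -leqNgt.
by rewrite /az_term /az_sign /= subn1 /= exprS exprD expr1; ring.
Qed.

Lemma prod_sum_merged (R : realType) (m : nat) (e : 'I_m -> az_entry)
    (n : nat) :
  \prod_j \sum_(k < n) az_term R (e j) k.+1 =
  \sum_(rho : 'S_m) merged_sum R e (codom rho) n.
Proof.
have := arrangement_weak_sum (fun j k => az_term R (e j) k.+1) n finset.setT.
rewrite cardsT card_ord arrangement_sum_setT => H.
rewrite (eq_bigl (mem (finset.setT : {set 'I_m}))) => [|j]; last first.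
  by rewrite /= !inE.
by rewrite -H; apply: eq_bigr => rho _; exact: weak_sumE.
Qed.

(* The second string collects the terms where the outermost index equals the
   next one, so the two together sum over n >= n_1. *)
Lemma nested_sum_strings (R : realType) (m l : nat) (i : 'I_m -> nat) (q : nat)
    (theta : composition m) (rho : 'S_m) (N : nat) : (0 < m)%N ->
  nested_sum R (string1 l i q theta rho) N +
  nested_sum R (string2 l i q theta rho) N =
  \sum_(k < N) az_term R (barred q) k.+1 *
    nested_sum R [seq T_tilde l i theta rho c | c <- iota 0 (size theta)] k.+1.
Proof.
move=> /(size_composition_gt0 theta).
rewrite /string1 /string2; case: (size theta) => // p _ /=.
rewrite -big_split /=; apply: eq_bigr => k _.
rewrite big_ord_recr /= mulrDr mulrA; congr (_ + _ * _).
rewrite /T_check1 /T_tilde /az_term.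
(* Multiplying by the sign of barred [q] flips the parity of the first block, so the merged entry is
   barred exactly when lambda_1 is even. *)
case: odd; rewrite /az_sign /= exprD invfM.
  by rewrite [RHS]mulrACA -exprMn mulrNN mulr1.
by rewrite [RHS]mulrACA -exprMn mulr1.
Qed.

Lemma alt_euler_partial_sum_strings (R : realType) (m l : nat) (i : 'I_m -> nat)
    (q N : nat) : (0 < m)%N ->
  alt_euler_partial_sum R l i q N =
  \sum_(theta : composition m) \sum_(rho : 'S_m)
    (-1) ^+ ((\sum_(c < size theta) lambda l theta rho c) + 1)%N /
    (\prod_(c < size theta) (nth 0%N theta c)`!)%N%:R *
    (nested_sum R (string1 l i q theta rho) N +
     nested_sum R (string2 l i q theta rho) N).
Proof.
move=> m0; rewrite alt_euler_partial_sumE.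
under [X in _ * X = _]eq_bigr => k _ do rewrite prod_sum_merged mulr_sumr.
rewrite [X in _ * X = _]exchange_big [RHS]exchange_big mulr_sumr /=.
apply: eq_bigr => rho _.
rewrite /merged_sum size_codom_perm.
under [X in _ * X = _]eq_bigr => k _ do rewrite -sum_composition mulr_sumr.
rewrite [X in _ * X = _]exchange_big mulr_sumr; apply: eq_bigr => theta _ /=.
rewrite nested_sum_strings // string_merge.
have -> : (\sum_(c < size theta) lambda l theta rho c =
    \sum_(j < m) (l <= j))%N.
  rewrite -(sum_reshape theta rho (fun j => (l <= j)%N : nat)).
  by apply: eq_bigr => c _; rewrite lambdaE.
have -> : (\prod_(c < size theta) (nth 0 theta c)`! = \prod_(t <- theta) t`!)%N.
  by rewrite (big_nth 0%N) big_mkord.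
rewrite -mulrA; congr (_ * _); rewrite mulr_sumr; apply: eq_bigr => k _.
by rewrite mulrCA.
Qed.

Theorem theorem4p3 (R : realType) (m l : nat) (i : 'I_m -> nat) (q : nat)
    (hm : (1 <= m)%N) (hl : (l <= m)%N) (hq : (1 <= q)%N)
    (hi : forall j : 'I_m, (1 <= i j)%N)
    (hi_unbarred : forall a b : 'I_m, (a <= b)%N -> (b < l)%N -> (i a <= i b)%N)
    (hi_barred : forall a b : 'I_m, (l <= a)%N -> (a <= b)%N -> (i a <= i b)%N) :
  [/\ cvgn (alt_euler_partial_sum R l i q),
      (forall (theta : composition m) (rho : 'S_m),
         cvgn (amzv_partial_sum R (string1 l i q theta rho)) /\
         cvgn (amzv_partial_sum R (string2 l i q theta rho))) &
      alt_euler_sum R l i q =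
      \sum_(theta : composition m) \sum_(rho : 'S_m)
        (-1) ^+ ((\sum_(c < size theta) lambda l theta rho c) + 1)%N /
        (\prod_(c < size theta) (nth 0%N theta c)`!)%N%:R *
        (amzv R (string1 l i q theta rho) + amzv R (string2 l i q theta rho))].
Proof.
have strings_cvg (theta : composition m) (rho : 'S_m) :
    cvgn (amzv_partial_sum R (string1 l i q theta rho)) /\
    cvgn (amzv_partial_sum R (string2 l i q theta rho)).
  have := all_merge_gt0 l hi (reshape_neq0 theta rho).
  rewrite -string_merge !amzv_partial_sumE /string1 /string2 => T0.
  (* The leading entry [barred q] carries a bar, so [q = 1] is covered. *)
  split; first exact: is_cvg_nested_sum.
  have t0 := size_composition_gt0 theta hm.
  case: (size theta) t0 T0 => // p _ /= /andP[T0 Tp].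
  (* The first entry of the second string may lack a bar, but its exponent is [q] plus a positive
     block sum, hence at least 2. *)
  have b0 : (0 < block_sum i theta rho 0)%N.
    by move: T0; rewrite /T_tilde; case: ifP.
  have c1 : (1 < (T_check1 l i q theta rho).1)%N.
    by rewrite /T_check1; case: ifP => _ /=; lia.
  by apply: is_cvg_nested_sum => //; rewrite ?c1 ?orbT // ltnW.
have L : (alt_euler_partial_sum R l i q @ \oo -->
    \sum_(theta : composition m) \sum_(rho : 'S_m)
      (-1) ^+ ((\sum_(c < size theta) lambda l theta rho c) + 1)%N /
      (\prod_(c < size theta) (nth 0%N theta c)`!)%N%:R *
      (amzv R (string1 l i q theta rho) + amzv R (string2 l i q theta rho)))%classic.
  (* The identity is exact at every cutoff, so the limit passes through a finite double sum. *)
  rewrite (funext (fun N => alt_euler_partial_sum_strings R l i q N hm)).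
  apply: cvg_big => [|theta _]; first exact: add_continuous.
  apply: cvg_big => [|rho _]; first exact: add_continuous.
  have [c1 c2] := strings_cvg theta rho.
  by apply: cvgMl_tmp; apply: cvgD; rewrite -amzv_partial_sumE.
split=> //; first exact: cvgP L.
exact: cvg_lim L.
Qed.
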